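(* Let $S,T$ be inverse semigroups and let $\mathcal{U}:S\to T$ be a non-degenerate inverse correspondence. Then $\mathcal{U}$ is a Morita equivalence if and only if $\mathcal{U}$ is an equivalence in the bicategory $\mathfrak{IC}$ of inverse semigroups and non-degenerate inverse correspondences, i.e. there exists a non-degenerate inverse correspondence $\mathcal{V}:T\to S$ such that $\mathcal{U}\otimes\mathcal{V}$ is isomorphic to $S$ as inverse correspondences from $S$ to $S$ and $\mathcal{V}\otimes\mathcal{U}$ is isomorphic to $T$ as inverse correspondences from $T$ to $T$.
   Context: A semigroup $T$ is inverse if every $t\in T$ has a unique $t^*\in T$ (its generalized inverse) with $tt^*t=t$ and $t^*tt^*=t^*$. A right $T$-set is a set $\mathcal{U}$ with a map $\mathcal{U}\times T\to\mathcal{U}$, $(u,t)\mapsto ut$, such that $(ut)t'=u(tt')$. A right regular $T$-set is a right $T$-set $\mathcal{U}$ with a map $\langle\cdot|\cdot\rangle_{\mathcal{U}}:\mathcal{U}\times\mathcal{U}\to T$ (the right pairing) such that for all $u,u'\in\mathcal{U}$, $t\in T$: (R-i) $\langle u|u't\rangle_{\mathcal{U}}=\langle u|u'\rangle_{\mathcal{U}}t$; (R-ii) $\langle u|u'\rangle_{\mathcal{U}}^*=\langle u'|u\rangle_{\mathcal{U}}$; (R-iii) $u\langle u|u\rangle_{\mathcal{U}}=u$. A right inverse $T$-set is a right regular $T$-set such that moreover (R-iv) $u\langle u'|u\rangle_{\mathcal{U}}=u$ and $u'\langle u|u'\rangle_{\mathcal{U}}=u'$ imply $u=u'$, for all $u,u'\in\mathcal{U}$.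 A left regular $S$-set is a set $\mathcal{U}$ with a left action of $S$ ($s'(su)=(s's)u$) and a map ${}_{\mathcal{U}}\langle\cdot|\cdot\rangle:\mathcal{U}\times\mathcal{U}\to S$ (left regular pairing) with ${}_{\mathcal{U}}\langle su|u'\rangle=s\,{}_{\mathcal{U}}\langle u|u'\rangle$, ${}_{\mathcal{U}}\langle u|u'\rangle^*={}_{\mathcal{U}}\langle u'|u\rangle$, ${}_{\mathcal{U}}\langle u|u\rangle u=u$. A partial Morita equivalence from $S$ to $T$ is a set $\mathcal{U}$ with commuting left $S$-action and right $T$-action ($s(ut)=(su)t$), a left regular pairing into $S$ and a right regular pairing into $T$, with ${}_{\mathcal{U}}\langle u|u'\rangle u''=u\langle u'|u''\rangle_{\mathcal{U}}$ for all $u,u',u''$. It is a Morita equivalence if in addition both pairings are full: $\{{}_{\mathcal{U}}\langle u|u'\rangle\}=S$ and $\{\langle u|u'\rangle_{\mathcal{U}}\}=T$ (as $u,u'$ range over $\mathcal{U}$). A map $\varphi:\mathcal{U}\to\mathcal{U}$ is adjointable if there is a map $\psi:\mathcal{U}\to\mathcal{U}$ with $\langle\psi(v)|u\rangle_{\mathcal{U}}=\langle v|\varphi(u)\rangle_{\mathcal{U}}$ for all $u,v\in\mathcal{U}$; $L(\mathcal{U})$ is the inverse semigroup of adjointable maps on $\mathcal{U}$ under composition. An inverse correspondence $\mathcal{U}:S\to T$ is a right inverse $T$-set $\mathcal{U}$ with a semigroup homomorphism $\theta_{\mathcal{U}}:S\to L(\mathcal{U})$; write $su=\theta_{\mathcal{U}}(s)(u)$.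 It is non-degenerate if $\{su\mid s\in S,u\in\mathcal{U}\}=\mathcal{U}$. A partial Morita equivalence becomes an inverse correspondence by forgetting its left pairing; an inverse correspondence $\mathcal{U}$ ''is a Morita equivalence'' if it arises in this way from a Morita equivalence, i.e. there is a left regular pairing on $\mathcal{U}$ which, together with the given actions and right pairing, makes $\mathcal{U}$ a Morita equivalence. Two inverse correspondences $\mathcal{U},\mathcal{U}':S\to T$ are isomorphic if there is a bijection $\sigma:\mathcal{U}\to\mathcal{U}'$ with $\sigma(su)=s\sigma(u)$ and $\langle\sigma(u)|\sigma(u')\rangle_{\mathcal{U}'}=\langle u|u'\rangle_{\mathcal{U}}$ for all $s\in S$, $u,u'\in\mathcal{U}$. Tensor product: for inverse correspondences $\mathcal{U}:S_1\to S_2$ and $\mathcal{V}:S_2\to S_3$, $\mathcal{U}\otimes\mathcal{V}$ is the quotient of $\mathcal{U}\times\mathcal{V}$ by the least equivalence relation with $(us_2,v)\sim(u,s_2v)$; the class of $(u,v)$ is $u\otimes v$. It is an inverse correspondence from $S_1$ to $S_3$ with $(u\otimes v)s_3=u\otimes(vs_3)$, $\langle u'\otimes v'|u\otimes v\rangle_{\mathcal{U}\otimes\mathcal{V}}=\langle v'|\langle u'|u\rangle_{\mathcal{U}}v\rangle_{\mathcal{V}}$ and $s_1(u\otimes v)=(s_1u)\otimes v$. An inverse semigroup $S$ is regarded as an inverse correspondence from $S$ to $S$ with actions by multiplication and right pairing $\langle s|s'\rangle_S=s^*s'$; it is the unit $1$-arrow of $S$ in $\mathfrak{IC}$, composition of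 $1$-arrows being the tensor product and $2$-arrows being the maps $\sigma$ (not necessarily bijective) that are left $S$-equivariant and preserve the right pairing. *)

(* Defs.v *)
From Stdlib Require Import Relation_Operators.
From HB Require Import structures.
From mathcomp Require Import all_boot.
From mathcomp Require Import generic_quotient boolp.

Set Implicit Arguments.
Unset Strict Implicit.
Unset Printing Implicit Defensive.

Local Open Scope group_scope.
Local Open Scope quotient_scope.

(* The carriers of semigroupType are choiceTypes; this is no restriction here *)
(* since boolp makes every type a choiceType. Carriers may be empty.          *)

Definition is_ginv (T : semigroupType) (t t' : T) : Prop :=
  t * t' * t = t /\ t' * t * t' = t'.

HB.mixin Record Semigroup_isInverse T of Semigroup T := {
  star : T -> T;
  starP : forall t : T, is_ginv t (star t);
  star_uniq : forall t t' : T, is_ginv t t' -> t' = star t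
}.

#[short(type="invSemigroupType")]
HB.structure Definition InvSemigroup := {T of Semigroup T & Semigroup_isInverse T}.

Notation "t ^*" := (star t) : group_scope.

Definition right_set (T : semigroupType) (U : Type) (ract : U -> T -> U) : Prop :=
  forall u t t', ract (ract u t) t' = ract u (t * t').

Definition left_set (S : semigroupType) (U : Type) (lact : S -> U -> U) : Prop :=
  forall s s' u, lact s' (lact s u) = lact (s' * s) u.

Record right_regular (T : invSemigroupType) (U : Type)
    (ract : U -> T -> U) (rp : U -> U -> T) : Prop := RightRegular {
  rreg_set : right_set ract;
  rreg_act : forall u u' t, rp u (ract u' t) = rp u u' * t;
  rreg_star : forall u u', (rp u u')^* = rp u' u;
  rreg_self : forall u, ract u (rp u u) = u
}.

Record right_inverse (T : invSemigroupType) (U : Type)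
    (ract : U -> T -> U) (rp : U -> U -> T) : Prop := RightInverse {
  rinv_regular : right_regular ract rp;
  rinv_sep : forall u u', ract u (rp u' u) = u -> ract u' (rp u u') = u' -> u = u'
}.

Record left_regular (S : invSemigroupType) (U : Type)
    (lact : S -> U -> U) (lp : U -> U -> S) : Prop := LeftRegular {
  lreg_set : left_set lact;
  lreg_act : forall s u u', lp (lact s u) u' = s * lp u u';
  lreg_star : forall u u', (lp u u')^* = lp u' u;
  lreg_self : forall u, lact (lp u u) u = u
}.

Record partial_morita (S T : invSemigroupType) (U : Type)
    (lact : S -> U -> U) (ract : U -> T -> U)
    (lp : U -> U -> S) (rp : U -> U -> T) : Prop := PartialMorita {
  pmor_left : left_regular lact lp;
  pmor_right : right_regular ract rp;
  pmor_comm : forall s u t, lact s (ract u t) = ract (lact s u) t;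
  pmor_compat : forall u u' u'', lact (lp u u') u'' = ract u (rp u' u'')
}.

Definition full_pairing (T U : Type) (p : U -> U -> T) : Prop :=
  forall t, exists u u', p u u' = t.

Definition morita (S T : invSemigroupType) (U : Type)
    (lact : S -> U -> U) (ract : U -> T -> U)
    (lp : U -> U -> S) (rp : U -> U -> T) : Prop :=
  [/\ partial_morita lact ract lp rp, full_pairing lp & full_pairing rp].

Definition is_adjoint (T U : Type) (rp : U -> U -> T) (phi psi : U -> U) : Prop :=
  forall u v, rp (psi v) u = rp v (phi u).

Definition adjointable (T U : Type) (rp : U -> U -> T) (phi : U -> U) : Prop :=
  exists psi, is_adjoint rp phi psi.

(* The last two fields say that lact is a semigroup homomorphism from S to    *)
(* the semigroup L(U) of adjointable maps under composition.                  *)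
Record invCorr (S T : invSemigroupType) := InvCorr {
  corr_sort :> choiceType;
  ract : corr_sort -> T -> corr_sort;
  rpair : corr_sort -> corr_sort -> T;
  lact : S -> corr_sort -> corr_sort;
  corr_right_inverse : right_inverse ract rpair;
  lact_adjointable : forall s, adjointable rpair (lact s);
  lactM : forall s s', lact (s * s') =1 lact s \o lact s'
}.

Definition nondegenerate (S T : invSemigroupType) (U : invCorr S T) : Prop :=
  forall u : U, exists s (u' : U), lact s u' = u.

Definition is_morita_equivalence (S T : invSemigroupType) (U : invCorr S T) : Prop :=
  exists lp : U -> U -> S, morita (@lact _ _ U) (@ract _ _ U) lp (@rpair _ _ U).

Definition corr_iso (S T : invSemigroupType) (U U' : invCorr S T) : Prop :=
  exists sigma : U -> U',
    [/\ bijective sigma,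
        forall s u, sigma (lact s u) = lact s (sigma u) &
        forall u u', rpair (sigma u) (sigma u') = rpair u u'].

Section InvSemigroupTheory.
Variable T : invSemigroupType.
Implicit Types t e f : T.

Lemma mulgVgK t : t * t^* * t = t. Proof. by case: (starP t). Qed.
Lemma mulVgVK t : t^* * t * t^* = t^*. Proof. by case: (starP t). Qed.

Lemma starK t : t^*^* = t.
Proof. by apply/esym/star_uniq; split; rewrite ?mulgVgK ?mulVgVK. Qed.

Lemma idem_star e : e * e = e -> e^* = e.
Proof. by move=> ee; apply/esym/star_uniq; split; rewrite !ee. Qed.

(* If e and f are idempotent, then f (ef)^* e is an idempotent inverse of ef. *)
Lemma idem_mul e f : e * e = e -> f * f = f -> e * f * (e * f) = e * f.
Proof.
move=> ee ff; set x := (e * f)^*.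
have xx : x * (e * f) * x = x by exact: mulVgVK.
have yx : f * x * e = x.
  apply: star_uniq; split.
    rewrite -[in RHS](mulgVgK (e * f)) -/x.
    by rewrite !mulgA -(mulgA e f f) ff -(mulgA (e * f * x) e e) ee.
  rewrite -[in RHS]xx.
  by rewrite !mulgA -(mulgA (f * x) e e) ee -(mulgA (f * x * e) f f) ff.
have xi : x * x = x.
  have fx : f * x = x by rewrite -yx !mulgA ff.
  have xe : x * e = x by rewrite -yx -!mulgA ee.
  by rewrite -[RHS]xx !mulgA xe -(mulgA x f) fx.
by have -> : e * f = x by rewrite -(starK (e * f)) -/x idem_star.
Qed.

Lemma idem_comm e f : e * e = e -> f * f = f -> e * f = f * e.
Proof.
move=> ee ff; have efi := idem_mul ee ff; have fei := idem_mul ff ee.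
rewrite -(idem_star efi); apply/esym/star_uniq; split.
  by rewrite !mulgA -(mulgA e f f) ff -(mulgA (e * f) e e) ee -mulgA.
by rewrite !mulgA -(mulgA f e e) ee -(mulgA (f * e) f f) ff -mulgA.
Qed.

Lemma mulgV_idem t : t * t^* * (t * t^*) = t * t^*.
Proof. by rewrite mulgA mulgVgK. Qed.

Lemma mulVg_idem t : t^* * t * (t^* * t) = t^* * t.
Proof. by rewrite mulgA mulVgVK. Qed.

Lemma starM t t' : (t * t')^* = t'^* * t^*.
Proof.
have C := idem_comm (mulVg_idem t) (mulgV_idem t').
apply/esym/star_uniq; split.
  have -> : t * t' * (t'^* * t^*) * (t * t') = t * ((t' * t'^*) * (t^* * t)) * t'.
    by rewrite !mulgA.
  by rewrite -C !mulgA mulgVgK -!mulgA (mulgA t') mulgVgK.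
have -> : t'^* * t^* * (t * t') * (t'^* * t^*) =
  t'^* * ((t^* * t) * (t' * t'^*)) * t^* by rewrite !mulgA.
by rewrite C !mulgA mulVgVK -!mulgA (mulgA t^*) mulVgVK.
Qed.

End InvSemigroupTheory.

Section RightInverseTheory.
Variables (T : invSemigroupType) (U : Type).
Variables (ra : U -> T -> U) (rp : U -> U -> T).
Hypothesis HU : right_inverse ra rp.
Implicit Types (u v : U) (phi psi p q : U -> U).

Let raA : right_set ra. Proof. by case: HU => -[]. Qed.
Let rpA u u' t : rp u (ra u' t) = rp u u' * t. Proof. by case: HU => -[]. Qed.
Let rpS u u' : (rp u u')^* = rp u' u. Proof. by case: HU => -[]. Qed.
Let raK u : ra u (rp u u) = u. Proof. by case: HU => -[]. Qed.
Let sep u u' : ra u (rp u' u) = u -> ra u' (rp u u') = u' -> u = u'.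
Proof. by case: HU => _; apply. Qed.

Lemma rpairAl u u' t : rp (ra u t) u' = t^* * rp u u'.
Proof. by rewrite -rpS rpA starM rpS. Qed.

Lemma rpair_idem u : rp u u * rp u u = rp u u.
Proof. by rewrite -rpA raK. Qed.

Lemma rpair_inj v w : (forall u, rp v u = rp w u) -> v = w.
Proof. by move=> e; apply: sep; rewrite ?e ?raK // -e raK. Qed.

Lemma is_adjoint_sym phi psi : is_adjoint rp phi psi -> is_adjoint rp psi phi.
Proof. by move=> a u v; rewrite -rpS -a rpS. Qed.

Lemma is_adjoint_comp f f' g g' : is_adjoint rp f f' -> is_adjoint rp g g' ->
  is_adjoint rp (f \o g) (g' \o f').
Proof. by move=> a b u v /=; rewrite b a. Qed.

Lemma adjoint_ract phi psi u t : is_adjoint rp phi psi ->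
  phi (ra u t) = ra (phi u) t.
Proof.
move=> /is_adjoint_sym a; apply: rpair_inj => v.
by rewrite a !rpairAl a.
Qed.

Lemma adjoint_regular phi psi : is_adjoint rp phi psi -> phi \o psi \o phi =1 phi.
Proof.
move=> a u /=; have a' := is_adjoint_sym a.
have eb : rp (phi u) (phi (psi (phi u))) = rp (psi (phi u)) (psi (phi u)).
  by rewrite -a.
have eb' : rp (phi (psi (phi u))) (phi u) = rp (psi (phi u)) (psi (phi u)).
  by rewrite -rpS eb rpS.
apply: sep; first by rewrite eb -(adjoint_ract _ _ a) raK.
have ea : rp (phi u) (phi u) = rp (phi u) (phi u) * rp (psi (phi u)) (psi (phi u)).
  by rewrite a' -rpA raK.
by rewrite eb' -{1}(raK (phi u)) raA -ea raK.
Qed.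

Definition projection p := is_adjoint rp p p /\ p \o p =1 p.

Lemma projectionE p u : projection p -> p u = ra u (rp u (p u)).
Proof.
move=> [a pp]; set c := rp u (p u).
have ec : rp (p u) (p u) = c by rewrite a -[p (p u)]/((p \o p) u) pp.
have cc : c * c = c by rewrite -ec rpair_idem.
have cs : c^* = c by exact: idem_star.
have ec' : rp (p u) u = c by rewrite -rpS cs.
apply: sep; first by rewrite rpairAl cs -/c cc -ec raK.
by rewrite raA rpA ec' !cc.
Qed.

Lemma projectionC p q : projection p -> projection q -> p \o q =1 q \o p.
Proof.
move=> hp hq u /=.
have idem r : projection r -> rp u (r u) * rp u (r u) = rp u (r u).
  move=> [a rr]; have <- : rp (r u) (r u) = rp u (r u).
    by rewrite a -[r (r u)]/((r \o r) u) rr.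
  exact: rpair_idem.
have Ep := projectionE u hp; have Eq := projectionE u hq.
rewrite {1}Eq Ep (adjoint_ract _ _ hp.1) (adjoint_ract _ _ hq.1).
by rewrite {1}Ep {2}Eq !raA idem_comm //; exact: idem.
Qed.

Lemma projection_adjoint phi psi : is_adjoint rp phi psi ->
  projection (phi \o psi).
Proof.
move=> a; have a' := is_adjoint_sym a; split; first exact: is_adjoint_comp.
by move=> u /=; rewrite -[RHS](adjoint_regular a (psi u)).
Qed.

Lemma projection_idem e e' : is_adjoint rp e e' -> e \o e =1 e -> projection e.
Proof.
move=> a ee; have a' := is_adjoint_sym a.
have C := projectionC (projection_adjoint a') (projection_adjoint a).
split=> // u v; rewrite -a; congr (rp _ u).
have h : e' v = e' (e (e (e' v))).
  by rewrite -[e (e _)]/((e \o e) (e' v)) ee; exact/esym/(adjoint_regular a' v).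
have C' : e' (e (e (e' v))) = e (e' (e' (e v))) := C v.
rewrite h C'.
have e'e' w : e' (e' w) = e' w.
  by apply: rpair_inj => z; rewrite !a -[e (e z)]/((e \o e) z) ee.
by rewrite e'e'; exact/esym/(adjoint_regular a v).
Qed.

(* Generalized inverses of adjointable maps are adjoints. *)
Lemma ginv_adjoint x y : adjointable rp x -> adjointable rp y ->
  x \o y \o x =1 x -> y \o x \o y =1 y -> is_adjoint rp x y.
Proof.
move=> [x' ax] [y' ay] xyx yxy.
suff e : y =1 x' by move=> u v; rewrite e ax.
have ax' := is_adjoint_sym ax.
have pxy : projection (x \o y).
  apply: (projection_idem (is_adjoint_comp ax ay)) => u /=.
  by have /= -> := yxy u.
have pyx : projection (y \o x).
  apply: (projection_idem (is_adjoint_comp ay ax)) => u /=.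
  by have /= -> := xyx u.
have C1 := projectionC (projection_adjoint ax) pxy.
have C2 := projectionC (projection_adjoint ax') pyx.
have R1 u : x (x' (x u)) = x u := adjoint_regular ax u.
have R2 u : x' (x (x' u)) = x' u := adjoint_regular ax' u.
have X u : x (y (x u)) = x u := xyx u.
have Y u : y (x (y u)) = y u := yxy u.
move=> u; have -> : y u = y (x (x' u)).
  have := C1 u; rewrite /= R1 => E.
  by rewrite -(Y u) E Y.
by have := C2 (x' u); rewrite /= R2 X R2 => <-.
Qed.

End RightInverseTheory.

Section CorrTheory.
Variables (S T : invSemigroupType) (U : invCorr S T).

Lemma ractM (u : U) t t' : ract (ract u t) t' = ract u (t * t').
Proof. by case: (corr_right_inverse U) => -[]. Qed.
Lemma rpair_ract (u u' : U) t : rpair u (ract u' t) = rpair u u' * t.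
Proof. by case: (corr_right_inverse U) => -[]. Qed.
Lemma rpair_star (u u' : U) : (rpair u u')^* = rpair u' u.
Proof. by case: (corr_right_inverse U) => -[]. Qed.
Lemma ract_rpair (u : U) : ract u (rpair u u) = u.
Proof. by case: (corr_right_inverse U) => -[]. Qed.
Lemma rpair_sep (u u' : U) :
  ract u (rpair u' u) = u -> ract u' (rpair u u') = u' -> u = u'.
Proof. by case: (corr_right_inverse U) => _; apply. Qed.
Lemma rpair_ractl (u u' : U) t : rpair (ract u t) u' = t^* * rpair u u'.
Proof. exact: rpairAl (corr_right_inverse U) _ _ _. Qed.

Lemma lact_comp s s' (u : U) : lact s (lact s' u) = lact (s * s') u.
Proof. by rewrite lactM. Qed.

Lemma lact_star s : is_adjoint (@rpair _ _ U) (lact s) (lact s^*).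
Proof.
apply: (ginv_adjoint (corr_right_inverse U)); try exact: lact_adjointable.
  by move=> u /=; rewrite !lact_comp mulgVgK.
by move=> u /=; rewrite !lact_comp mulVgVK.
Qed.

Lemma rpair_lact s (v u : U) : rpair (lact s v) u = rpair v (lact s^* u).
Proof. by rewrite -lact_star starK. Qed.

Lemma lact_ract s (u : U) t : lact s (ract u t) = ract (lact s u) t.
Proof. exact: (adjoint_ract (corr_right_inverse U) _ _ (lact_star s)). Qed.

Lemma lact_idem s (u : U) : s * s = s -> lact s u = ract u (rpair u (lact s u)).
Proof.
move=> ss; apply: (projectionE (corr_right_inverse U)); split.
  by have := lact_star s; rewrite idem_star.
by move=> v /=; rewrite lact_comp ss.
Qed.

Lemma ract_ginv (u u' : U) :
  ract u' (rpair u' u) = ract u (rpair u u' * rpair u' u).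
Proof.
have a : is_adjoint (@rpair _ _ U) (fun w => ract u' (rpair u' w))
                    (fun w => ract u' (rpair u' w)).
  by move=> w v /=; rewrite rpair_ractl rpair_ract rpair_star.
rewrite (projectionE (corr_right_inverse U) (p := fun w => ract u' (rpair u' w))).
  by rewrite rpair_ract.
by split=> // w /=; rewrite rpair_ract -ractM ract_rpair.
Qed.

End CorrTheory.

Section UnitCorr.
Variable S : invSemigroupType.

Definition unit_rpair (s s' : S) : S := s^* * s'.

Lemma unit_right_inverse : right_inverse (fun s t : S => s * t) unit_rpair.
Proof.
rewrite /unit_rpair; split; first split.
- by move=> u t t'; rewrite mulgA.
- by move=> u u' t; rewrite mulgA.
- by move=> u u'; rewrite starM starK.
- by move=> u; rewrite mulgA mulgVgK.
move=> u u'; rewrite !mulgA => h h'.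
have : u'^* = u^*.
  apply: star_uniq; split=> //.
  by have := congr1 (@star S) h'; rewrite !starM starK mulgA.
by move/(congr1 (@star S)); rewrite !starK.
Qed.

Lemma unit_adjointable s : adjointable unit_rpair (fun u : S => s * u).
Proof. by exists (fun u => s^* * u) => u v; rewrite /unit_rpair starM starK mulgA. Qed.

Lemma unit_lactM (s s' : S) :
  (fun u => s * s' * u) =1 (fun u => s * u) \o (fun u => s' * u).
Proof. by move=> u /=; rewrite mulgA. Qed.

Definition unit_corr : invCorr S S :=
  @InvCorr S S S (fun u t => u * t) unit_rpair (fun s u => s * u)
    unit_right_inverse unit_adjointable unit_lactM.

Lemma unit_nondegenerate : nondegenerate unit_corr.
Proof. by move=> s; exists (s * s^*), s; exact: mulgVgK. Qed.

End UnitCorr.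

Section Tensor.
Variables (S1 S2 S3 : invSemigroupType) (U : invCorr S1 S2) (V : invCorr S2 S3).

Inductive tensor_step : U * V -> U * V -> Prop :=
  TensorStep u s v : tensor_step (ract u s, v) (u, lact s v).

(* clos_refl_sym_trans R is the least equivalence relation containing R. *)
Definition tensor_rel : rel (U * V) :=
  fun x y => `[< clos_refl_sym_trans (U * V)%type tensor_step x y >].

Lemma tensor_rel_is_equiv : equiv_class_of tensor_rel.
Proof.
split.
- by move=> x; apply/asboolP; exact: rst_refl.
- by move=> x y; apply/asboolP/asboolP => h; exact: rst_sym.
- by move=> y x z /asboolP h /asboolP h'; apply/asboolP; exact: rst_trans h h'.
Qed.

Canonical tensor_equiv := EquivRelPack tensor_rel_is_equiv.

Definition tensor_type : choiceType := {eq_quot tensor_equiv}.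

Definition tens (u : U) (v : V) : tensor_type := \pi_({eq_quot tensor_equiv}) (u, v).

Definition trepr (x : tensor_type) : U * V := repr (x : {eq_quot tensor_equiv}).

(* The operations are defined on representatives; tens_ract, tens_rpair and   *)
(* tens_lact below show that they do not depend on the choice.                *)
Definition tensor_ract (x : tensor_type) (t : S3) : tensor_type :=
  tens (trepr x).1 (ract (trepr x).2 t).

Definition tensor_rpair (x' x : tensor_type) : S3 :=
  rpair (trepr x').2 (lact (rpair (trepr x').1 (trepr x).1) (trepr x).2).

Definition tensor_lact (s : S1) (x : tensor_type) : tensor_type :=
  tens (lact s (trepr x).1) (trepr x).2.

Lemma tensK x : tens (trepr x).1 (trepr x).2 = x.
Proof. by rewrite /tens -surjective_pairing reprK. Qed.

Lemma tens_eqP u v u' v' : tens u v = tens u' v' <->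
  clos_refl_sym_trans (U * V)%type tensor_step (u, v) (u', v').
Proof.
by split=> [/eqmodP/asboolP //|h]; apply/eqmodP/asboolP.
Qed.

Lemma tens_bal u s v : tens (ract u s) v = tens u (lact s v).
Proof. by apply/tens_eqP/rst_step. Qed.

Lemma tens_ind (P : tensor_type -> Prop) :
  (forall u v, P (tens u v)) -> forall x, P x.
Proof. by move=> h x; rewrite -(tensK x). Qed.

Lemma tens_lift (A : Type) (f : U -> V -> A) :
  (forall u s v, f (ract u s) v = f u (lact s v)) ->
  forall u v, f (trepr (tens u v)).1 (trepr (tens u v)).2 = f u v.
Proof.
move=> h u v; have /tens_eqP := tensK (tens u v).
rewrite -surjective_pairing.
pose g (p : U * V) := f p.1 p.2; rewrite -/(g (trepr _)) -[f u v]/(g (u, v)).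
by elim=> [_ _ []|||x y z _ -> _ ->] // *; exact: h.
Qed.

Lemma tens_ract u v t : tensor_ract (tens u v) t = tens u (ract v t).
Proof.
apply: (tens_lift (f := fun u v => tens u (ract v t))) => {}u s {}v.
by rewrite tens_bal lact_ract.
Qed.

Lemma tens_lact s u v : tensor_lact s (tens u v) = tens (lact s u) v.
Proof.
apply: (tens_lift (f := fun u v => tens (lact s u) v)) => {}u s' {}v.
by rewrite lact_ract tens_bal.
Qed.

Lemma tens_rpair u' v' u v : tensor_rpair (tens u' v') (tens u v) =
  rpair v' (lact (rpair u' u) v).
Proof.
rewrite /tensor_rpair.
rewrite (tens_lift (f := fun u v => rpair (trepr (tens u' v')).2
  (lact (rpair (trepr (tens u' v')).1 u) v))); last first.
  by move=> a s b; rewrite rpair_ract lact_comp.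
rewrite (tens_lift (f := fun u' v' => rpair v' (lact (rpair u' u) v))) //.
by move=> a s b; rewrite rpair_ractl rpair_lact lact_comp.
Qed.

Lemma tensor_right_inverse : right_inverse tensor_ract tensor_rpair.
Proof.
have rgA : right_set tensor_ract.
  by elim/tens_ind=> u v t t'; rewrite !tens_ract ractM.
have rgP x x' t : tensor_rpair x (tensor_ract x' t) = tensor_rpair x x' * t.
  elim/tens_ind: x => u v; elim/tens_ind: x' => u' v'.
  by rewrite tens_ract !tens_rpair lact_ract rpair_ract.
have rgS x x' : (tensor_rpair x x')^* = tensor_rpair x' x.
  elim/tens_ind: x => u v; elim/tens_ind: x' => u' v'.
  by rewrite !tens_rpair rpair_star rpair_lact rpair_star.
have rgK x : tensor_ract x (tensor_rpair x x) = x.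
  elim/tens_ind: x => u v; rewrite tens_rpair tens_ract -lact_idem.
    by rewrite -tens_bal ract_rpair.
  exact: rpair_idem (corr_right_inverse U) _.
split=> //; elim/tens_ind=> u v; elim/tens_ind=> u' v' e e'.
set r := tensor_rpair (tens u' v') (tens u v) in e.
have rr : r * r = r by rewrite /r -rgP e.
have rs : r^* = r by exact: idem_star.
have er' : tensor_rpair (tens u v) (tens u' v') = r by rewrite -rgS rs.
rewrite er' in e'; rewrite !tens_ract in e e'.
set s := rpair u' u.
have rE : r = rpair v' (lact s v) by rewrite /r tens_rpair.
have sv : ract (lact s v) r = ract v' r.
  by apply: rpair_sep; rewrite rpair_ract rpair_ractl rs ?(mulgA r);
    rewrite -?rE -?(rpair_star v') -?rE ?rs ractM ?mulgA !rr.
rewrite -e -e' -sv -lact_ract -tens_bal.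
have <- : lact s^* (ract v' r) = ract v r.
  have rE' : r = rpair v (lact s^* v').
    by rewrite -rpair_lact -rpair_star -rE rs.
  by apply: rpair_sep; rewrite lact_ract rpair_ract rpair_ractl rs;
    rewrite -?(rpair_star v) -?rE' ?rs ractM ?mulgA !rr.
rewrite -!tens_bal -sv -lact_ract -!tens_bal !ractM rpair_star.
by rewrite mulgA -(rpair_star u' u) mulgVgK rpair_star ract_ginv.
Qed.

Lemma tensor_adjointable s : adjointable tensor_rpair (tensor_lact s).
Proof.
exists (tensor_lact s^*); elim/tens_ind=> u v; elim/tens_ind=> u' v'.
by rewrite !tens_lact !tens_rpair rpair_lact starK.
Qed.

Lemma tensor_lactM s s' : tensor_lact (s * s') =1 tensor_lact s \o tensor_lact s'.
Proof. by elim/tens_ind=> u v /=; rewrite !tens_lact lact_comp. Qed.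

Definition tensor : invCorr S1 S3 :=
  InvCorr tensor_right_inverse tensor_adjointable tensor_lactM.

Lemma tensor_nondegenerate : nondegenerate U -> nondegenerate tensor.
Proof.
move=> h; elim/tens_ind=> u v; have [s [u' <-]] := h u.
by exists s, (tens u' v); exact: tens_lact.
Qed.

End Tensor.

(* A 2-arrow is invertible exactly when it is bijective, so equivalences in   *)
(* the bicategory are expressed through corr_iso.                             *)
Definition is_equivalence_IC (S T : invSemigroupType) (U : invCorr S T) : Prop :=
  exists V : invCorr T S,
    [/\ nondegenerate V,
        corr_iso (tensor U V) (unit_corr S) &
        corr_iso (tensor V U) (unit_corr T)].

(* Main.v *)
Require Import Defs.
From HB Require Import structures.
From mathcomp Require Import all_boot.
From mathcomp Require Import boolp.

(** Forward direction.  A Morita equivalence has a mirror image: the same set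
    with the left pairing playing the role of the right pairing and both
    actions twisted by the generalized inverse.  This dual is an inverse
    correspondence from [T] to [S], the separation axiom being that of [U]
    because the two pairings are tied by [<u|u'> u'' = u <u'|u''>].  The two
    pairings themselves, seen as maps on the tensor products, are then the
    required isomorphisms: they preserve the right pairings (which makes them
    injective) and fullness makes them onto.

    Backward direction.  Write [F u v] and [G v u] for the images of the
    elementary tensors under the isomorphisms onto [S] and [T].  A left pairing
    must send [(u, u')] to an element of [S] acting as the rank-one operator
    [w |-> u <u'|w>].  Such an element is unique, as [S] acts faithfully
    ([equiv_faithful]), and choosing it makes all the axioms automatic, so
    everything rests on existence ([equiv_rank_one]).  For an adjoint
    equivalence, [F u v * w = u * G v w], so it is enough to realise [<u'|w>] as
    [G v w] for some [v]; this is possible since [u'] itself has the form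
    [F u' v0 * u0].  For an arbitrary equivalence the two isomorphisms need not
    fit together, but the two ways to contract [U (x) V (x) U] to [U] both preserve
    the right pairing, hence differ by a left [S]-equivariant surjection [psi]
    of [U], and [F u v * psi w = u * G v w] is all that the argument uses. *)

Set Implicit Arguments.
Unset Strict Implicit.
Unset Printing Implicit Defensive.

Local Open Scope group_scope.

(** * Faithfulness and surjective isometries *)

(** Equality at [a^* * a] and [b^* * b] says that [a] and [b] lie below each
    other in the natural partial order. *)
Lemma mulg_faithful (S : invSemigroupType) (a b : S) :
  (forall s, a * s = b * s) -> a = b.
Proof.
move=> ab.
have aE : a = b * (a^* * a) by rewrite -ab mulgA mulgVgK.
have bE : b = a * (b^* * b) by rewrite ab mulgA mulgVgK.
rewrite [RHS]bE {2}aE -mulgA (idem_comm (mulVg_idem a) (mulVg_idem b)).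
by rewrite mulgA (mulgA b) mulgVgK.
Qed.

Lemma isometry_inj (S T : invSemigroupType) (U U' : invCorr S T)
    (sigma : U -> U') :
  (forall u u', rpair (sigma u) (sigma u') = rpair u u') -> injective sigma.
Proof.
move=> iso u u' e; apply: (rpair_inj (corr_right_inverse U)) => w.
by rewrite -iso e iso.
Qed.

Lemma isometry_bij (S T : invSemigroupType) (U U' : invCorr S T)
    (sigma : U -> U') :
  (forall u u', rpair (sigma u) (sigma u') = rpair u u') ->
  (forall w, exists u, sigma u = w) -> bijective sigma.
Proof.
move=> iso /choice [tau tauK]; exists tau => // u.
exact: (isometry_inj iso).
Qed.

(** A balanced map of two variables, specified by its values on elementary
    tensors, gives an isomorphism from the tensor product onto the unit. *)
Lemma tensor_unit_iso (S T : invSemigroupType)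
    (U : invCorr S T) (V : invCorr T S) (F : U -> V -> S) :
  (forall u t v, F (ract u t) v = F u (lact t v)) ->
  (forall s u v, F (lact s u) v = s * F u v) ->
  (forall u v u' v', (F u v)^* * F u' v' = rpair v (lact (rpair u u') v')) ->
  (forall s, exists u v, F u v = s) ->
  corr_iso (tensor U V) (unit_corr S).
Proof.
move=> bal equiv iso surj.
pose sigma (x : tensor U V) : unit_corr S := F (trepr x).1 (trepr x).2.
have sigmaE u v : sigma (tens u v) = F u v by exact: (tens_lift bal).
have sigma_iso x y : rpair (sigma x) (sigma y) = rpair x y.
  elim/tens_ind: x => u v; elim/tens_ind: y => u' v'.
  by rewrite !sigmaE /= tens_rpair -iso.
exists sigma; split=> //.
- apply: isometry_bij sigma_iso _ => s; have [u [v <-]] := surj s.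
  by exists (tens u v).
- by move=> s; elim/tens_ind=> u v; rewrite /= tens_lact !sigmaE equiv.
Qed.

(** * The dual of a Morita equivalence *)

Section Dual.
Variables (S T : invSemigroupType) (U : invCorr S T) (lp : U -> U -> S).
Hypothesis HU : morita (@lact _ _ U) (@ract _ _ U) lp (@rpair _ _ U).

Let lpA s u u' : lp (lact s u) u' = s * lp u u'.
Proof. by case: HU => -[[]]. Qed.
Let lpS u u' : (lp u u')^* = lp u' u.
Proof. by case: HU => -[[]]. Qed.
Let lpK u : lact (lp u u) u = u.
Proof. by case: HU => -[[]]. Qed.
Let compat u u' u'' : lact (lp u u') u'' = ract u (rpair u' u'').
Proof. by case: HU => -[]. Qed.
Let lp_full s : exists u u', lp u u' = s.
Proof. by case: HU. Qed.
Let rp_full t : exists u u', rpair (u : U) u' = t.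
Proof. by case: HU. Qed.

Let lpAr s u u' : lp u (lact s u') = lp u u' * s^*.
Proof. by rewrite -lpS lpA starM lpS. Qed.

(** The right action is adjointable for the left pairing: the two sides agree
    after multiplication by any [lp w z], that is by any element of [S]. *)
Lemma morita_lp_ract u t u' : lp (ract u t) u' = lp u (ract u' t^*).
Proof.
apply: mulg_faithful => s; have [w [z <-]] := lp_full s.
by rewrite -!lpA !compat rpair_ractl starK ractM.
Qed.

Lemma dual_right_inverse : Defs.right_inverse (fun (u : U) s => lact s^* u) lp.
Proof.
split; first split=> //.
- by move=> u s s'; rewrite lact_comp starM.
- by move=> u u' s; rewrite lpAr starK.
- by move=> u; rewrite lpS lpK.
by move=> u u'; rewrite !lpS !compat; exact: rpair_sep.
Qed.

Lemma dual_adjointable t : adjointable lp (fun u : U => ract u t^*).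
Proof. by exists (fun u => ract u t) => u v; exact: morita_lp_ract. Qed.

Lemma dual_lactM t t' : (fun u : U => ract u (t * t')^*) =1
  (fun u => ract u t^*) \o (fun u => ract u t'^*).
Proof. by move=> u /=; rewrite ractM starM. Qed.

Definition dual : invCorr T S :=
  InvCorr dual_right_inverse dual_adjointable dual_lactM.

Lemma dual_nondegenerate : nondegenerate dual.
Proof.
move=> u; exists (rpair (u : U) u), u.
by rewrite /= rpair_star ract_rpair.
Qed.

Lemma tensor_dualr : corr_iso (tensor U dual) (unit_corr S).
Proof.
apply: (@tensor_unit_iso _ _ U dual lp) => //=; first exact: morita_lp_ract.
by move=> u v u' v'; rewrite rpair_star -compat lpAr !lpS.
Qed.

Lemma tensor_dual : corr_iso (tensor dual U) (unit_corr T).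
Proof.
apply: (@tensor_unit_iso _ _ dual U (@rpair _ _ U)) => //=.
- by move=> u s v; rewrite rpair_lact starK.
- by move=> t u v; rewrite rpair_ractl starK.
- by move=> u v u' v'; rewrite compat rpair_ract rpair_star.
Qed.

End Dual.

(** * The left pairing of an equivalence *)

(** What the converse needs of the two isomorphisms, in terms of elementary
    tensors. *)
Section Equivalence.
Variables (S T : invSemigroupType) (U : invCorr S T) (V : invCorr T S).
Variables (F : U -> V -> S) (G : V -> U -> T).
Hypothesis hU : nondegenerate U.
Hypothesis FA : forall s u v, F (lact s u) v = s * F u v.
Hypothesis GA : forall t v u, G (lact t v) u = t * G v u.
Hypothesis F_surj : forall s, exists u v, F u v = s.
Hypothesis G_surj : forall t, exists v u, G v u = t.
Hypothesis F_iso : forall u v u' v',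
  (F u v)^* * F u' v' = rpair v (lact (rpair u u') v').
Hypothesis G_iso : forall v u v' u',
  (G v u)^* * G v' u' = rpair u (lact (rpair v v') u').

Lemma equiv_faithful s s' : (forall u : U, lact s u = lact s' u) -> s = s'.
Proof.
move=> e; apply: mulg_faithful => r; have [u [v <-]] := F_surj r.
by rewrite -!FA e.
Qed.

Lemma equiv_rpair_full : full_pairing (@rpair _ _ U).
Proof.
move=> t; have [v [u e]] := G_surj (t * t^*); have [v' [u' e']] := G_surj t.
exists u, (lact (rpair v v') u').
by rewrite -G_iso e e' idem_star ?mulgVgK // mulgV_idem.
Qed.

Lemma contraction_isometry u v w u' v' w' :
  rpair (ract u (G v w)) (ract u' (G v' w')) =
  rpair (lact (F u v) w) (lact (F u' v') w').
Proof.
by rewrite rpair_ractl rpair_ract -GA G_iso rpair_lact lact_comp F_iso.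
Qed.

(** Nondegeneracy makes every element of [U] a value of the left contraction,
    so that [psi] is defined everywhere; its equivariance turns
    [psi (F u v * w)] into [F u v * psi w]. *)
Lemma equiv_twist : exists psi : U -> U,
  (forall w, exists w', psi w' = w) /\
  forall u v w, lact (F u v) (psi w) = ract u (G v w).
Proof.
have lcontr w : exists p : U * V * U, lact (F p.1.1 p.1.2) p.2 = w.
  have [s [w' <-]] := hU w; have [u [v <-]] := F_surj s.
  by exists (u, v, w').
have [c cK] := choice lcontr.
pose psi w := ract (c w).1.1 (G (c w).1.2 (c w).2).
have psiE u v w : psi (lact (F u v) w) = ract u (G v w).
  have psi_self z : rpair (psi z) (psi z) = rpair z z.
    by rewrite contraction_isometry cK.
  apply: rpair_sep; rewrite contraction_isometry cK.
    by rewrite -psi_self ract_rpair.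
  by rewrite -contraction_isometry ract_rpair.
have psiA s w : psi (lact s w) = lact s (psi w).
  rewrite -{1}(cK w) lact_comp -FA psiE -lact_ract.
  by rewrite -psiE cK.
exists psi; split=> [w|u v w]; last by rewrite -psiA psiE.
have [v [w' e]] := G_surj (rpair w w).
by exists (lact (F w v) w'); rewrite psiE e ract_rpair.
Qed.

Lemma equiv_rank_one (u u' : U) :
  exists s, forall w, lact s w = ract u (rpair u' w).
Proof.
have [psi [psi_surj psiE]] := equiv_twist.
(* Write u' as F u' v0 * psi u0, then move F u' v0 across the pairing. *)
have [v0 [u0 e0]] := G_surj (rpair u' u').
have u'E : u' = lact (F u' v0) (psi u0) by rewrite psiE e0 ract_rpair.
have [a [b ab]] := F_surj (F u' v0)^*.
exists (F u (lact (rpair (psi u0) a) b)) => z; have [w <-] := psi_surj z.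
by rewrite psiE GA [in RHS]u'E rpair_lact -ab psiE rpair_ract.
Qed.

Lemma equiv_morita : is_morita_equivalence U.
Proof.
have [lp2 lp2E] := choice (fun p : U * U => equiv_rank_one p.1 p.2).
pose lp u u' := lp2 (u, u').
have lpE u u' w : lact (lp u u') w = ract u (rpair u' w) := lp2E (u, u') w.
have lpA s u u' : lp (lact s u) u' = s * lp u u'.
  by apply: equiv_faithful => w; rewrite -lact_comp !lpE lact_ract.
have lpS u u' : (lp u u')^* = lp u' u.
  apply: equiv_faithful => w.
  apply: (rpair_inj (corr_right_inverse U)) => z.
  by rewrite rpair_lact starK !lpE rpair_ractl rpair_ract rpair_star.
have lpK u : lact (lp u u) u = u by rewrite lpE ract_rpair.
exists lp; split; last exact: equiv_rpair_full.
- split=> //; last by move=> *; exact: lact_ract.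
    by split=> // s s' u; rewrite lact_comp.
  by case: (corr_right_inverse U).
- (* If s = F u v, then lp u u fixes s on the left, so s^* = lp (s^* u) u. *)
  move=> s; have [u [v e]] := F_surj s; exists u, (lact s^* u).
  by rewrite -lpS lpA starM starK lpS -{1}e -FA lpK.
Qed.

End Equivalence.

(** An isomorphism from a tensor product onto the unit, read on elementary
    tensors. *)
Lemma tensor_unit_isoE (S T : invSemigroupType)
    (U : invCorr S T) (V : invCorr T S) :
  corr_iso (tensor U V) (unit_corr S) -> exists F : U -> V -> S,
  [/\ forall s u v, F (lact s u) v = s * F u v,
      forall s, exists u v, F u v = s &
      forall u v u' v', (F u v)^* * F u' v' = rpair v (lact (rpair u u') v')].
Proof.
move=> [sigma [[tau _ tauK] equiv iso]].
exists (fun u v => sigma (tens u v)); split.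
- by move=> s u v; rewrite -tens_lact; exact: equiv.
- by move=> s; exists (trepr (tau s)).1, (trepr (tau s)).2; rewrite tensK tauK.
- by move=> u v u' v'; rewrite -tens_rpair; exact: iso.
Qed.

Theorem theorem5p16 (S T : invSemigroupType) (U : invCorr S T) (hU : nondegenerate U) :
  is_morita_equivalence U <-> is_equivalence_IC U.
Proof.
split=> [[lp HU]|[V [_ /tensor_unit_isoE[F [FA Fs Fi]]]]].
  exists (dual HU).
  by split; [exact: dual_nondegenerate|exact: tensor_dualr|exact: tensor_dual].
move=> /tensor_unit_isoE[G [GA Gs Gi]].
exact: (equiv_morita hU FA GA Fs Gs Fi Gi).
Qed.
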